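(* For every integer $m\ge2$, there exist instances of the Data-Fusion problem (that is, choices of $p$, $q$, $s$, $G\in\mathbb{R}^{p\times m}$ and $H\in\mathbb{R}^{q\times m}$) with $s-q=m-1$ for which the natural bound and the spectral bound satisfy $\mathfrak{z}_{\mathcal{N}}>\mathfrak{z}_{\mathcal{S}}$.
   Context: An instance is given by $G\in\mathbb{R}^{p\times m}$, $H\in\mathbb{R}^{q\times m}$ with $B:=H^\top H$ positive definite, $P:=\{1,\dots,p\}$, and an integer $s$ with $0<s-q<p$. The Data-Fusion problem is $\max\{\operatorname{ldet}(B+G^\top\operatorname{Diag}(x)G):\mathbf{e}^\top x=s-q,\ x\in\{0,1\}^p\}$, where $\operatorname{ldet}$ is log-determinant, $\mathbf{e}$ the all-ones vector, $\operatorname{Diag}(x)$ the diagonal matrix with diagonal $x$. $\lambda_i(X)$ denotes the $i$-th largest eigenvalue of a symmetric matrix $X$. Natural bound: $\mathfrak{z}_{\mathcal{N}}:=\max\{\operatorname{ldet}(B+G^\top\operatorname{Diag}(x)G):\mathbf{e}^\top x=s-q,\ 0\le x_i\le1\ (i\in P)\}$. Spectral bound: $\mathfrak{z}_{\mathcal{S}}:=\operatorname{ldet}(B)+\sum_{i=1}^{s-q}\log\big(1+\lambda_i(GB^{-1}G^\top)\big)$. *)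

(* Defs.v *)
From mathcomp Require Import all_boot all_order all_algebra.
From mathcomp Require Import classical_sets reals exp.
From mathcomp.real_closed Require Import polyrcf.

Set Implicit Arguments.
Unset Strict Implicit.
Unset Printing Implicit Defensive.

Import Order.TTheory GRing.Theory Num.Theory.

Local Open Scope ring_scope.

Definition posdefmx (R : realType) (n : nat) (A : 'M[R]_n) : Prop :=
  A^T = A /\ forall x : 'cV[R]_n, x != 0 -> 0 < (x^T *m A *m x) 0 0.

(* Decreasing, with algebraic multiplicity: rootsR is the increasing list of the
   distinct roots. For a symmetric matrix the characteristic polynomial splits
   over R, so the list has exactly n entries. *)
Definition eigenvalues (R : realType) (n : nat) (A : 'M[R]_n) : seq R :=
  rev (flatten [seq nseq (mup a (char_poly A)) a | a <- rootsR (char_poly A)]).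

(* i ranges over 1, ..., n; junk outside that range. *)
Definition lambda (R : realType) (n : nat) (i : nat) (A : 'M[R]_n) : R :=
  nth 0 (eigenvalues A) i.-1.

(* Only meaningful when \det A > 0 (ln is 0 on nonpositive reals); it is used
   below on positive definite matrices. *)
Definition ldet (R : realType) (n : nat) (A : 'M[R]_n) : R := ln (\det A).

(* With s and q natural numbers, q < s makes the truncated s - q exact. *)
Definition data_fusion_instance (R : realType) (m p q s : nat)
    (G : 'M[R]_(p, m)) (H : 'M[R]_(q, m)) : Prop :=
  [/\ posdefmx (H^T *m H), (q < s)%N & (s - q < p)%N].

Definition natural_feasible (R : realType) (p k : nat) (x : 'rV[R]_p) : Prop :=
  \sum_i x 0 i = k%:R /\ forall i, 0 <= x 0 i <= 1.

Definition data_fusion_objective (R : realType) (m p q : nat)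
    (G : 'M[R]_(p, m)) (H : 'M[R]_(q, m)) (x : 'rV[R]_p) : R :=
  ldet (H^T *m H + G^T *m diag_mx x *m G).

Definition is_maximum (R : realType) (A : set R) (z : R) : Prop :=
  A z /\ ubound A z.

Definition is_natural_bound (R : realType) (m p q s : nat)
    (G : 'M[R]_(p, m)) (H : 'M[R]_(q, m)) (z : R) : Prop :=
  is_maximum
    (data_fusion_objective G H @`
       [set x : 'rV[R]_p | natural_feasible (s - q) x])%classic z.

Definition spectral_bound (R : realType) (m p q s : nat)
    (G : 'M[R]_(p, m)) (H : 'M[R]_(q, m)) : R :=
  let B := H^T *m H in
  ldet B + \sum_(1 <= i < (s - q).+1) ln (1 + lambda i (G *m invmx B *m G^T)).

(* Main.v *)
(** Take G = H = I_m, with q = p = m and s = 2m - 1. The objective is then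
    ln (prod_i (1 + x_i)), where the m factors 1 + x_i have sum 2m - 1, so by
    AM-GM its maximum is attained at the constant x and equals
    m ln ((2m - 1) / m). The spectral bound is the logarithm of 2^(m-1) * 1, a
    product of m nonnegative reals, not all equal, with the same sum 2m - 1, so
    the equality case of AM-GM makes it strictly smaller. *)

Require Import Defs.
From mathcomp Require Import all_boot all_order all_algebra.
From mathcomp Require Import classical_sets reals exp.
From mathcomp.real_closed Require Import polyrcf.
Import Order.TTheory GRing.Theory Num.Theory.
Local Open Scope ring_scope.

Lemma char_poly_scalar (R : comNzRingType) (n : nat) (a : R) :
  char_poly (a%:M : 'M_n) = ('X - a%:P) ^+ n.
Proof.
by rewrite /char_poly /char_poly_mx map_scalar_mx -raddfB det_scalar.
Qed.

Lemma rootsR_exp_XsubC (R : rcfType) (n : nat) (a : R) :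
  rootsR (('X - a%:P) ^+ n.+1) = [:: a].
Proof.
have p0 : ('X - a%:P) ^+ n.+1 != 0 by rewrite expf_neq0 ?polyXsubC_eq0.
(* A strictly increasing list is determined by its members, so comparing roots suffices. *)
apply: (@lt_sorted_eq _ R) => //; first exact: sorted_roots.
by move=> x; rewrite -(roots_on_rootsR p0) in_itv root_exp_XsubC inE.
Qed.

Lemma eigenvalues_scalar (R : realType) (n : nat) (a : R) :
  eigenvalues (a%:M : 'M_n.+1) = nseq n.+1 a.
Proof.
rewrite /eigenvalues char_poly_scalar rootsR_exp_XsubC /= cats0.
by rewrite mup_XsubCX eqxx rev_nseq.
Qed.

Lemma posdefmx1 (R : realType) (n : nat) : posdefmx (1%:M : 'M[R]_n).
Proof.
split=> [|x x_neq0]; first exact: trmx1.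
rewrite mulmx1 mxE lt_def psumr_neq0 => [|i _]; last first.
  by rewrite mxE -expr2 sqr_ge0.
rewrite sumr_ge0 => [|i _]; last by rewrite mxE -expr2 sqr_ge0.
rewrite andbT; have /cV0Pn[i xi_neq0] := x_neq0.
apply/hasP; exists i; first exact: mem_index_enum.
by rewrite mxE -expr2 exprn_even_gt0.
Qed.

Lemma data_fusion_objective1 (R : realType) (n : nat) (x : 'rV[R]_n) :
  data_fusion_objective 1%:M 1%:M x = ln (\prod_i (1 + x 0 i)).
Proof.
rewrite /data_fusion_objective /ldet trmx1 !mul1mx mulmx1.
rewrite -diag_const_mx -raddfD det_diag.
by under eq_bigr do rewrite !mxE.
Qed.

(** Here [G *m invmx B *m G^T] is the identity, so every eigenvalue is 1 and each of the [s - n]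
    terms equals [ln 2]; the hypothesis keeps the indices within the list of [n] eigenvalues, away
    from the default 0. *)
Lemma spectral_bound1 (R : realType) (n s : nat) : (s - n <= n)%N ->
  spectral_bound s (1%:M : 'M[R]_n) 1%:M = ln (2 ^+ (s - n)).
Proof.
case: n => [|n] le_sn.
  by move: le_sn; rewrite leqn0 => /eqP s0; rewrite /spectral_bound s0 big_nil
    /ldet trmx1 mulmx1 det1 addr0 expr0.
rewrite /spectral_bound /ldet trmx1 !mulmx1 invmx1 mulmx1 det1 ln1 add0r.
(* The exponent is rewritten as the length of the range from 1 to [s - n.+1], so that the two sums
   compare termwise. *)
rewrite lnXn // -[X in _ *+ X](subn1 (s - n.+1).+1) -sumr_const_nat.
apply: eq_big_nat => i /andP[i_gt0 i_lt].
rewrite /lambda eigenvalues_scalar nth_nseq ifT //.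
by rewrite prednK // (leq_trans _ le_sn).
Qed.

Lemma prodr_leif_mean (R : realFieldType) (n : nat) (x : 'I_n -> R) :
  (forall i, 0 <= x i) ->
  \prod_i x i <= ((\sum_i x i) / n%:R) ^+ n
    ?= iff [forall i, forall j, x i == x j].
Proof.
move=> x_ge0; rewrite -[n in n%:R]card_ord -[X in _ ^+ X]card_ord.
exact: (leif_AGM (A := predT) (fun i _ => x_ge0 i)).
Qed.

Lemma exp2_lt_mean (R : realFieldType) (n : nat) :
  (2 ^+ n.+1 : R) < (1 + n.+1%:R / n.+2%:R) ^+ n.+2.
Proof.
(* The [n.+1] factors 2 are padded with one factor 1: the product is unchanged and the [n.+2]
   numbers sum to [n.+2 + n.+1]. *)
pose x (i : 'I_n.+2) : R := if i == ord0 then 1 else 2.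
have x_ge0 i : 0 <= x i by rewrite /x; case: ifP.
have prod_x : \prod_i x i = 2 ^+ n.+1.
  by rewrite big_ord_recl mul1r prodr_const card_ord.
have sum_x : (\sum_i x i) / n.+2%:R = 1 + n.+1%:R / n.+2%:R.
  rewrite big_ord_recl sumr_const card_ord -[X in _ = X + _](@divff _ n.+2%:R).
    by rewrite -mulrDl /x /= -mulrnA -mulrS -natrD mul2n -addnn.
  by rewrite pnatr_eq0.
rewrite -prod_x -sum_x (lt_leif (prodr_leif_mean _ _ _ x_ge0)).
(* Equality in AM-GM would force the entry 1 at [ord0] to equal the entry 2 at [ord_max]. *)
apply/negP => /forallP/(_ ord0)/forallP/(_ ord_max).
by rewrite /x /= lt_eqF ?ltr1n.
Qed.

Lemma is_natural_bound1 (R : realType) (n s : nat) :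
  (0 < n)%N -> (s - n <= n)%N ->
  is_natural_bound s (1%:M : 'M[R]_n) 1%:M
    (ln ((1 + (s - n)%:R / n%:R) ^+ n)).
Proof.
move=> n_gt0 le_sn; have n_neq0 : n%:R != 0 :> R by rewrite pnatr_eq0 -lt0n.
have mean_gt0 : 0 < 1 + (s - n)%:R / n%:R :> R.
  by rewrite ltr_pwDl // divr_ge0.
split.
  (* The budget [s - n] is spread evenly; [le_sn] keeps the entries at most 1. *)
  exists (const_mx ((s - n)%:R / n%:R)).
    split=> [|i].
      under eq_bigr do rewrite mxE.
      by rewrite sumr_const card_ord -[LHS]mulr_natr divfK.
    by rewrite mxE divr_ge0 //= ler_pdivrMr ?ltr0n // mul1r ler_nat.
  rewrite data_fusion_objective1; under eq_bigr do rewrite mxE.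
  by rewrite prodr_const card_ord.
move=> _ [x [sum_x x01] <-]; rewrite data_fusion_objective1.
have x1_gt0 i : 0 < 1 + x 0 i by rewrite ltr_pwDl //; case/andP: (x01 i).
rewrite ler_ln ?posrE ?exprn_gt0 ?prodr_gt0 //.
(* The sum constraint fixes the mean of the [1 + x 0 i], so AM-GM yields a bound independent of
   [x]. *)
have -> : 1 + (s - n)%:R / n%:R = (\sum_i (1 + x 0 i)) / n%:R.
  by rewrite big_split /= sumr_const card_ord sum_x mulrDl divff.
by have [] := prodr_leif_mean _ _ _ (fun i => ltW (x1_gt0 i)).
Qed.

Theorem theorem17 (R : realType) (m : nat) (hm : (2 <= m)%N) :
  exists (p q s : nat) (G : 'M[R]_(p, m)) (H : 'M[R]_(q, m)),
    [/\ data_fusion_instance s G H,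
        (s - q)%N = (m - 1)%N
      & exists zN : R, is_natural_bound s G H zN /\ spectral_bound s G H < zN].
Proof.
case: m hm => [|[|n]] // _.
have sE : (n.+2 + n.+1 - n.+2 = n.+1)%N by rewrite addKn.
exists n.+2, n.+2, (n.+2 + n.+1)%N, 1%:M, 1%:M; split.
- split; first by rewrite trmx1 mulmx1; exact: posdefmx1.
    by rewrite -addn1 leq_add2l.
  by rewrite sE.
- by rewrite sE subn1.
exists (ln ((1 + (n.+2 + n.+1 - n.+2)%:R / n.+2%:R) ^+ n.+2)); split.
  by apply: is_natural_bound1; rewrite ?sE.
rewrite spectral_bound1 sE // ltr_ln ?posrE ?exprn_gt0 //.
  exact: exp2_lt_mean.
by rewrite ltr_pwDl // divr_ge0.
Qed.
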